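(* For every positive integer $n$ there exists an extremal square-free word of length at least $n$ over a $3$-letter alphabet.
   Context: A square is a non-empty word of the form $XX$; a word is square-free if it contains no square as a factor (contiguous subword). Let $\mathbb A$ be a finite alphabet and $W$ a finite word over $\mathbb A$. An extension of $W$ is any word of the form $W'xW''$ where $x\in\mathbb A$ and $W=W'W''$ (the words $W'$, $W''$ may be empty, so a letter may be inserted at any position, including the beginning and the end). A square-free word $W$ over $\mathbb A$ is extremal over $\mathbb A$ if no extension of $W$ is square-free. *)

(* Defs.v *)
(* The letters of the alphabet are the elements of a type T, and words are
   elements of seq T. *)
From mathcomp Require Import all_boot.

Set Implicit Arguments.
Unset Strict Implicit.
Unset Printing Implicit Defensive.

Definition square (T : eqType) (s : seq T) : Prop :=
  exists2 x : seq T, x != [::] & s = x ++ x.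

Definition square_free (T : eqType) (w : seq T) : Prop :=
  forall s : seq T, infix s w -> ~ square s.

Definition extension (T : eqType) (w e : seq T) : Prop :=
  exists (w1 w2 : seq T) (x : T), w = w1 ++ w2 /\ e = w1 ++ x :: w2.

(* Extremality is relative to the alphabet: the inserted letter ranges over
   all of T. *)
Definition extremal (T : finType) (w : seq T) : Prop :=
  square_free w /\ forall e : seq T, extension w e -> ~ square_free e.

(* Main.v *)
(* A 47-uniform morphism maps the letters 0, 1, 2 to the three cyclic shifts of
   a palindrome; it preserves square-freeness, and inserting a letter into the
   middle one of three consecutive blocks always creates a square. Two more
   blocks, the images of new letters 3 and 4 (mirror images of one another),
   close the word at both ends: for every letter c = 0, 1, 2 the word starts with
   Y c Y for some, possibly empty, Y, so that prepending c creates a square.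
   The extremal words are the images of 3 u 4, where u is an iterate of the
   morphism. All blocks were found by computer search. *)
Require Import Defs.
From mathcomp Require Import all_boot.
From mathcomp Require Import zify.

Set Implicit Arguments.
Unset Strict Implicit.
Unset Printing Implicit Defensive.

(** * Squares and square-free words *)

Lemma square_free_infix (T : eqType) (v w : seq T) :
  infix v w -> square_free w -> square_free v.
Proof. by move=> vw wF s sv; apply: wF; apply: infix_trans vw. Qed.

(** Squares become periodicity conditions on positions, so that later arguments about them reduce to
    linear arithmetic. *)
Lemma square_free_nthN (T : eqType) (x0 : T) (w : seq T) (i p : nat) :
  square_free w -> 0 < p -> i + p + p <= size w ->
  ~ (forall j, i <= j < i + p -> nth x0 w j = nth x0 w (j + p)).
Proof.
move=> wF p0 iw eqw.
have sz k : k + p <= size w -> size (take p (drop k w)) = p.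
  by move=> kp; rewrite size_takel // size_drop; lia.
apply: (wF (take (p + p) (drop i w))).
  by apply: infix_trans (infix_take _ _) (infix_drop _ _).
exists (take p (drop i w)); first by rewrite -size_eq0 sz -?lt0n //; lia.
rewrite takeD drop_drop; congr (_ ++ _); apply: (@eq_from_nth _ x0).
  by rewrite !sz; lia.
move=> j; rewrite sz; last lia; move=> jp.
rewrite !nth_take // !nth_drop.
have -> : p + i + j = i + j + p by lia.
by apply/esym/eqw; lia.
Qed.

Lemma square_free_nth (T : eqType) (x0 : T) (w : seq T) :
  (forall i p, 0 < p -> i + p + p <= size w ->
     ~ (forall j, i <= j < i + p -> nth x0 w j = nth x0 w (j + p))) ->
  square_free w.
Proof.
move=> H s /infixP[a [b ew]] [x x0' es].
have szw : size w = size a + size x + size x + size b.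
  by rewrite ew es !size_cat; lia.
apply: (H (size a) (size x)); first by rewrite lt0n size_eq0.
  by rewrite szw; lia.
move=> j /andP[aj jx]; rewrite ew es -catA !nth_cat.
have -> : j < size a = false by lia.
have -> : j + size x < size a = false by lia.
have -> : j - size a < size x by lia.
have -> : j + size x - size a < size x = false by lia.
have -> : j + size x - size a - size x = j - size a by lia.
by have -> : j - size a < size x by lia.
Qed.

Lemma square_free_rev (T : eqType) (w : seq T) :
  square_free (rev w) -> square_free w.
Proof.
move=> wF s sw [x x0 es]; apply: (wF (rev s)); first by rewrite infix_rev.
by exists (rev x); [rewrite -size_eq0 size_rev size_eq0 | rewrite es rev_cat].
Qed.

(** A square starting at the new letter would contain it again at the start of its second half. *)
Lemma square_free_cons (T : eqType) (a : T) (w : seq T) :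
  a \notin w -> square_free w -> square_free (a :: w).
Proof.
move=> aw wF s; rewrite infix_consl => /orP[|/wF//].
move=> /prefixP[t et] [[//|y x] _ es]; move: et; rewrite es /= => -[ya ew].
by move: aw; rewrite ew ya !mem_cat inE eqxx !orbT.
Qed.

Lemma square_free_map (T U : eqType) (f : T -> U) (w : seq T) :
  {in w &, injective f} -> square_free w -> square_free (map f w).
Proof.
move=> fI wF s /infixP[a [b ew]] [x x0 es].
(* A non-empty [w] supplies the default letter that [nth] requires. *)
have [t0|t0] := eqVneq w [::]; first by move: ew x0; rewrite t0 es; case: a; case: x {es}.
case: w t0 => // y0 w' _ in fI wF ew *; set w := y0 :: w' in fI wF ew *.
have szw : size w = size a + size x + size x + size b.
  by rewrite -(size_map f) ew es !size_cat; lia.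
apply: (@square_free_nthN _ y0 w (size a) (size x)) => //.
- by rewrite lt0n size_eq0.
- by rewrite szw; lia.
move=> j /andP[aj jx].
apply: fI; rewrite ?mem_nth //; try lia.
rewrite -!(nth_map y0 (f y0)); try lia.
rewrite ew es -catA !nth_cat.
have -> : j < size a = false by lia.
have -> : j + size x < size a = false by lia.
have -> : j - size a < size x by lia.
have -> : j + size x - size a < size x = false by lia.
have -> : j + size x - size a - size x = j - size a by lia.
by have -> : j - size a < size x by lia.
Qed.

Lemma square_free_of_map (T U : eqType) (f : T -> U) (w : seq T) :
  square_free (map f w) -> square_free w.
Proof.
move=> wF s /infixP[a [b ew]] [x x0 es]; apply: (wF (map f s)).
  by apply/infixP; exists (map f a), (map f b); rewrite ew !map_cat.
by exists (map f x); [rewrite -size_eq0 size_map size_eq0 | rewrite es map_cat].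
Qed.

(** * A boolean test for square-freeness *)

(* Nested [if]s rather than [&&] and [||], which call-by-value evaluation would
   not short-circuit. *)
Fixpoint eq_take (T : eqType) (p : nat) (s t : seq T) : bool :=
  match p, s, t with
  | 0, _, _ => true
  | p'.+1, x :: s', y :: t' => if x == y then eq_take p' s' t' else false
  | _, _, _ => false
  end.

(* To be called with [t = drop p s]. *)
Fixpoint square_prefix (T : eqType) (s : seq T) (p : nat) (t : seq T) : bool :=
  if t is _ :: t' then
    if eq_take p s t then true else square_prefix s p.+1 t'
  else false.

Fixpoint square_freeb (T : eqType) (w : seq T) : bool :=
  if w is _ :: w' then
    if square_prefix w 1 w' then false else square_freeb w'
  else true.

Lemma eq_takeP (T : eqType) (p : nat) (s t : seq T) :
  eq_take p s t = [&& p <= size s, p <= size t & take p s == take p t].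
Proof.
elim: p s t => [|p IH] [|x s] [|y t] //=; rewrite ?take0 ?andbF //.
rewrite IH !ltnS eqseq_cons; case: (x == y) => //=; by rewrite !andbF.
Qed.

Lemma square_prefixP (T : eqType) (s t : seq T) (p : nat) :
  t = drop p s ->
  reflect (exists2 q, p <= q < size s & eq_take q s (drop q s))
          (square_prefix s p t).
Proof.
elim: t p => [|y t IH] p et /=.
  constructor=> -[q /andP[pq qs] _].
  by have := congr1 size et; rewrite size_drop /=; lia.
have ps : p < size s by have := congr1 size et; rewrite size_drop /=; lia.
rewrite et; case E: (eq_take _ _ _); first by constructor; exists p; rewrite ?leqnn.
have /IH ht : t = drop p.+1 s by rewrite -add1n -drop_drop -et /= drop0.
apply: (iffP ht) => -[q Hq Eq]; exists q => //; first by lia.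
have [eqp|] := eqVneq p q; last by lia.
by move: E; rewrite eqp Eq.
Qed.

Lemma square_freeP (T : eqType) (w : seq T) :
  reflect (square_free w) (square_freeb w).
Proof.
elim: w => [|a w IH]; first by constructor=> s /[!infixs0] /eqP-> [[]].
rewrite /=; case: square_prefixP => [|Hq|H]; first by rewrite /= drop0.
  constructor=> wF; case: Hq => q /andP[q0 qs].
  rewrite eq_takeP => /and3P[_ szq /eqP eqq].
  apply: (wF (take (q + q) (a :: w))); first exact: infix_take.
  exists (take q (a :: w)); last by rewrite takeD -eqq.
  by rewrite -size_eq0 size_takel; lia.
case: IH => IH; constructor.
  move=> s; rewrite infix_consl => /orP[/prefixP[t et]|/IH//].
  move=> [x x0 es]; apply: H; exists (size x).
    by rewrite et es !size_cat lt0n size_eq0 x0; case: (x) x0 => //= *; lia.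
  rewrite eq_takeP et es -catA take_size_cat // drop_size_cat //.
  by rewrite take_size_cat // eqxx !size_cat; lia.
by move=> wF; apply: IH; apply: square_free_infix wF; exact: infix_cons.
Qed.

(** * Uniform morphisms and square-freeness *)

Definition morph (B T : eqType) (h : B -> seq T) (u : seq B) : seq T :=
  flatten (map h u).

Lemma morph_cat (B T : eqType) (h : B -> seq T) (u v : seq B) :
  morph h (u ++ v) = morph h u ++ morph h v.
Proof. by rewrite /morph map_cat flatten_cat. Qed.

Lemma size_morph (B T : eqType) (h : B -> seq T) (L : nat) (u : seq B) :
  (forall b, size (h b) = L) -> size (morph h u) = size u * L.
Proof. by move=> hL; elim: u => //= b u IH; rewrite size_cat hL IH; lia. Qed.

Lemma drop_morph (B T : eqType) (h : B -> seq T) (L k : nat) (u : seq B) :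
  (forall b, size (h b) = L) -> drop (k * L) (morph h u) = morph h (drop k u).
Proof.
move=> hL; elim: k u => [|k IH] u; first by rewrite !drop0.
case: u => [//|b u]; rewrite [morph h _]/= mulSn addnC -drop_drop.
by rewrite -(hL b) drop_size_cat // hL IH.
Qed.

Lemma take_morph (B T : eqType) (h : B -> seq T) (L k : nat) (u : seq B) :
  (forall b, size (h b) = L) -> take (k * L) (morph h u) = morph h (take k u).
Proof.
move=> hL; elim: k u => [|k IH] u; first by rewrite !take0.
case: u => [//|b u]; rewrite [morph h _]/= mulSn takeD.
by rewrite -(hL b) take_size_cat // drop_size_cat // hL IH.
Qed.

Lemma nth_morph (B T : eqType) (h : B -> seq T) (b0 : B) (x0 : T)
    (L k r : nat) (u : seq B) :
  (forall b, size (h b) = L) -> k < size u -> r < L ->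
  nth x0 (morph h u) (k * L + r) = nth x0 (h (nth b0 u k)) r.
Proof.
move=> hL ku rL; rewrite -nth_drop (@drop_morph _ _ _ L) //.
by rewrite (drop_nth b0 ku) /= nth_cat hL rL.
Qed.

(* If a square of period [p >= 2 * L - 1] occurs in [morph h u], its first half
   contains a whole block, whose copy in the second half must be aligned with
   the blocks, so [L] divides [p]. The two extreme blocks of the first half are
   covered only partially: either the first one on its letters [m .. L - 1], or
   the last one on its letters [0 .. m]; this yields a square in [u]. *)
Lemma square_free_morph (B T : eqType) (b0 : B) (x0 : T) (h : B -> seq T)
    (L m : nat) (u : seq B) :
  (forall b, size (h b) = L) -> m < L ->
  {in u &, forall a b, drop m (h a) = drop m (h b) -> a = b} ->
  {in u &, forall a b, take m.+1 (h a) = take m.+1 (h b) -> a = b} ->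
  (forall a b c d, infix [:: a; b] u -> c \in u -> 0 < d < L ->
     take L (drop d (h a ++ h b)) <> h c) ->
  (forall v, infix v u -> size v <= 5 -> square_free (morph h v)) ->
  square_free u -> square_free (morph h u).
Proof.
move=> hL mL dropI takeI sync short uF; apply: (@square_free_nth _ x0) => i p p0.
rewrite (@size_morph _ _ _ L) // => ip eqi.
have L0 : 0 < L by lia.
have Ei := divn_eq i L; have rL := ltn_pmod i L0.
set k := i %/ L in Ei; set r := i %% L in Ei rL.
have nthE := nth_morph b0 x0 hL.
have lt_blocks a b : a * L < b * L -> a < b by rewrite ltn_pmul2r.
(* A square of length at most [4 * L - 4] starting at offset [r < L] of block [k] fits into the five
   blocks from [k] on. *)
have [plt|ple] := leqP (p + p) (4 * L - 4).
  have szv : size (take 5 (drop k u)) <= 5 by rewrite size_take; case: ifP; lia.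
  have := short _ (infix_trans (infix_take _ _) (infix_drop _ _)) szv.
  move/(@square_free_nthN _ x0 _ r p); apply=> //.
    rewrite -(take_morph _ _ hL) -(drop_morph _ _ hL).
    rewrite size_take size_drop (@size_morph _ _ _ L) //; case: ifP; lia.
  move=> j rj; rewrite -(take_morph _ _ hL) -(drop_morph _ _ hL).
  rewrite !nth_take; try lia.
  by rewrite !nth_drop addnA; apply: eqi; lia.
(* The ceiling of [i / L]: block [k1] is the first to begin at or after [i], and it ends by
   [i + 2 * L - 1 <= i + p]. *)
pose k1 := (i + L - 1) %/ L.
have := divn_eq (i + L - 1) L; have := ltn_pmod (i + L - 1) L0.
rewrite -/k1; move: (_ %% L) => r1 r1L Ei1.
have Ep := divn_eq p L; have dL := ltn_pmod p L0.
set q := p %/ L in Ep; set d := p %% L in Ep dL.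
have k1u : k1 < size u by apply: lt_blocks; lia.
have d0 : d = 0.
  apply/eqP; rewrite -leqn0 leqNgt; apply/negP=> d0.
  have kqu : k1 + q + 1 < size u by apply: lt_blocks; rewrite !mulnDl; lia.
  apply: (sync (nth b0 u (k1 + q)) (nth b0 u (k1 + q + 1)) (nth b0 u k1) d).
  - apply/infixP; exists (take (k1 + q) u), (drop (k1 + q + 2) u).
    rewrite -[LHS](cat_take_drop (k1 + q)); congr (_ ++ _).
    rewrite (drop_nth b0); last lia.
    rewrite (drop_nth b0); last lia.
    by rewrite -addn1 addn2 addn1.
  - exact: mem_nth.
  - by rewrite d0 dL.
  apply: (@eq_from_nth _ x0); first by rewrite hL size_takel // size_drop size_cat !hL; lia.
  move=> j; rewrite size_takel; last by rewrite size_drop size_cat !hL; lia.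
  move=> jL; rewrite nth_take // nth_drop nth_cat hL -(nthE k1) // eqi; last lia.
  case: ltnP => djL; rewrite -nthE; try lia; congr nth; rewrite !mulnDl; lia.
have {}Ep : p = q * L by lia.
have q0 : 0 < q by rewrite lt0n; apply/eqP=> q0; move: Ep; rewrite q0; lia.
have blk c j : c < size u -> c + q < size u -> j < L -> i <= c * L + j < i + p ->
    nth x0 (h (nth b0 u c)) j = nth x0 (h (nth b0 u (c + q))) j.
  by move=> cu cqu jL cj; rewrite -!nthE // eqi // mulnDl Ep addnAC.
have full c : i <= c * L + m < i + p -> c + q < size u ->
    (i <= c * L + m /\ c.+1 * L <= i + p) \/ (i <= c * L /\ c * L + m < i + p) ->
    nth b0 u c = nth b0 u (c + q).
  move=> cm cqu [[ci cp]|[ci cp]].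
  - apply: dropI; rewrite ?mem_nth //; try lia.
    apply: (@eq_from_nth _ x0); first by rewrite !size_drop !hL.
    by move=> j; rewrite size_drop hL => jm; rewrite !nth_drop; apply: blk; lia.
  - apply: takeI; rewrite ?mem_nth //; try lia.
    have szt b : size (take m.+1 (h b)) = m.+1 by rewrite size_takel ?hL.
    apply: (@eq_from_nth _ x0); first by rewrite !szt.
    by move=> j; rewrite szt => jm; rewrite !nth_take //; apply: blk; lia.
have bounds k2 c : k2 <= c < k2 + q -> k2 * L <= c * L /\ c * L + L <= k2 * L + p.
  by move=> /andP[kc cq]; rewrite Ep -mulnDl -mulSnr !leq_pmul2r.
have [rm|mr] := leqP r m.
  have kqu : k + q + q <= size u.
    by rewrite -ltnS; apply: lt_blocks; rewrite mulSn !mulnDl; lia.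
  apply: (@square_free_nthN _ b0 _ k q uF) => // c kc.
  have [kc1 kc2] := bounds _ _ kc.
  by apply: full; [lia|lia|left; rewrite mulSn; lia].
(* Since [r > m >= 0], the square extends into block [k + 2 * q], so that block exists and the
   square in [u] may start at [k + 1]. *)
have kqu : k.+1 + q + q <= size u.
  by rewrite -ltnS; apply: lt_blocks; rewrite mulSn !mulnDl mulSn; lia.
apply: (@square_free_nthN _ b0 _ k.+1 q uF) => // c kc.
have [] := bounds _ _ kc; rewrite mulSn => kc1 kc2.
by apply: full; [lia|lia|right; lia].
Qed.

(** * The five blocks and the finite checks on them *)

Definition base_block : seq nat :=
  [:: 0; 1; 2; 0; 2; 1; 0; 2; 0; 1; 2; 1; 0; 2; 1; 2; 0; 1; 2; 1; 0; 1; 2; 0;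
      2; 1; 0; 1; 2; 1; 0; 2; 1; 2; 0; 1; 2; 1; 0; 2; 0; 1; 2; 0; 2; 1; 0].

(** Its prefixes [Y c Y] have [Y] empty for [c = 2], [Y = 2] for [c = 0] and [Y = 20210120102] for
    [c = 1]. *)
Definition left_block : seq nat :=
  [:: 2; 0; 2; 1; 0; 1; 2; 0; 1; 0; 2; 1; 2; 0; 2; 1; 0; 1; 2; 0; 1; 0; 2; 0;
      1; 2; 1; 0; 1; 2; 0; 1; 0; 2; 1; 2; 0; 2; 1; 0; 1; 2; 0; 1; 0; 2; 1].

(** The wildcard branch is meant for 4; it also keeps the morphism 47-uniform on all of [nat]. *)
Definition block (b : nat) : seq nat :=
  match b with
  | 0 | 1 | 2 => [seq (x + b) %% 3 | x <- base_block]
  | 3 => left_block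
  | _ => rev left_block
  end.

Fixpoint words (k : nat) : seq (seq nat) :=
  if k is k'.+1 then [seq x :: w | x <- iota 0 3, w <- words k'] else [:: [::]].

(** For [k <= 5], covers all factors of length [k] of [3 u 4] when [u] is ternary, square-free,
    begins with 0120 and ends with 0210. *)
Definition windows (k : nat) : seq (seq nat) :=
  take k [:: 3; 0; 1; 2; 0] :: drop (5 - k) [:: 0; 2; 1; 0; 4] ::
  [seq w <- words k | square_freeb w].

(* Erasing all but 43 letters on each side of the insertion keeps a square and
   speeds up the check; 43 is the least radius that works. *)
Definition insert_squares (v : seq nat) : bool :=
  let w := morph block v in
  let lo := if head 0 v == 3 then 0 else 47 in
  let hi := if last 0 v == 4 then 141 else 94 in
  all (fun r => all (fun x => ~~ square_freeb
      (drop (r - 43) (take (r + 44) (take r w ++ x :: drop r w))))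
    (iota 0 3)) (iota lo (hi - lo).+1).

Lemma insert_squares_windows : all insert_squares (windows 3).
Proof. by vm_compute. Qed.

Lemma square_free_windows :
  all (fun k => all (fun v => square_freeb (morph block v)) (windows k))
    (iota 0 6).
Proof. by vm_compute. Qed.

(** Synchronization: this excludes periods that are not multiples of 47 in long squares. *)
Lemma block_sync :
  all (fun v => all (fun c => all (fun d =>
      take 47 (drop d (morph block v)) != block c)
    (iota 1 46)) (iota 0 5)) (windows 2).
Proof. by vm_compute. Qed.

(** Index 23 is the middle of a block, so either half including the middle letter determines the
    block. *)
Lemma block_inj :
  all (fun a => all (fun b =>
      ((drop 23 (block a) == drop 23 (block b)) ==> (a == b)) &&
      ((take 24 (block a) == take 24 (block b)) ==> (a == b)))
    (iota 0 5)) (iota 0 5).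
Proof. by vm_compute. Qed.

(** * Short factors and square-free images under [block] *)

Lemma size_block (b : nat) : size (block b) = 47.
Proof. by case: b => [|[|[|[|b]]]]. Qed.

Lemma size_morph_block (u : seq nat) : size (morph block u) = size u * 47.
Proof. exact: size_morph size_block. Qed.

Notation ternary := (all (fun x => x < 3)).

Lemma ternary_morph_block (u : seq nat) : ternary (morph block u).
Proof.
elim: u => //= b u IH; rewrite all_cat IH andbT.
by case: b => [|[|[|[|b]]]].
Qed.

Lemma mem_words (v : seq nat) : ternary v -> v \in words (size v).
Proof.
elim: v => [//|x v IH] /andP[x3 /IH vw].
by apply/allpairsP; exists (x, v); rewrite mem_iota.
Qed.

Lemma mem_windows (v : seq nat) :
  ternary v -> square_free v -> v \in windows (size v).
Proof.
by move=> v3 vF; rewrite !inE mem_filter mem_words // andbT; apply/orP; right;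
  apply/orP; right; apply/square_freeP.
Qed.

Lemma infix_windows (u v : seq nat) :
  ternary u -> square_free u -> infix v u -> v \in windows (size v).
Proof.
move=> u3 uF vu; apply: mem_windows; last exact: square_free_infix uF.
by apply/allP=> x xv; apply: (allP u3); apply: mem_infix xv.
Qed.

(** A factor touching a border has at most four letters beside it, all known from the prefix or
    suffix of [u]; any other factor lies in [u]. *)
Lemma infix_bordered_windows (u v : seq nat) :
  ternary u -> square_free u -> prefix [:: 0; 1; 2; 0] u ->
  suffix [:: 0; 2; 1; 0] u -> infix v (3 :: rcons u 4) -> size v <= 5 ->
  v \in windows (size v).
Proof.
move=> u3 uF /prefixP[u1 eu1] /suffixP[u2 eu2] + v5.
rewrite infix_consl infix_rconsl => /or3P[|| vu]; last exact: infix_windows vu.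
- rewrite prefixE eu1 rcons_cat -(cat_cons 3) takel_cat // => /eqP <-.
  by rewrite size_takel // mem_head.
- rewrite suffixE eu2 rcons_cat size_cat /= -addnBA // drop_cat.
  rewrite ltnNge leq_addr /= addKn => /eqP <-.
  by rewrite size_drop subKn // inE mem_head orbT.
Qed.

Lemma square_free_morph_block (u : seq nat) :
  all (fun x => x < 5) u ->
  (forall v, infix v u -> size v <= 5 -> v \in windows (size v)) ->
  square_free u -> square_free (morph block u).
Proof.
move=> u5 win; have mem5 a : a \in u -> a \in iota 0 5.
  by move=> /(allP u5); rewrite mem_iota.
have inj a b : a \in u -> b \in u ->
    ((drop 23 (block a) == drop 23 (block b)) ==> (a == b)) &&
    ((take 24 (block a) == take 24 (block b)) ==> (a == b)).
  by move=> /mem5/(allP block_inj)/allP + /mem5 => /[apply].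
apply: (@square_free_morph _ _ 0 0 _ 47 23) => //; first exact: size_block.
- by move=> a b au bu e; have := inj a b au bu; rewrite e eqxx => /andP[/eqP].
- by move=> a b au bu e; have := inj a b au bu; rewrite e eqxx => /andP[_ /eqP].
- move=> a b c d abu cu d47; have := win _ abu isT.
  move=> /(allP block_sync)/allP/(_ c (mem5 c cu))/allP/(_ d).
  by rewrite mem_iota /morph /= cats0 => /(_ d47) /eqP.
- move=> v vu v5; apply/square_freeP.
  have : size v \in iota 0 6 by rewrite mem_iota.
  by move=> /(allP square_free_windows)/allP; apply; apply: win.
Qed.

(** * Iterates of the morphism *)

Definition thue (n : nat) : seq nat := iter n (morph block) base_block.

Lemma thueP (n : nat) :
  [/\ ternary (thue n), square_free (thue n), prefix [:: 0; 1; 2; 0] (thue n),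
      suffix [:: 0; 2; 1; 0] (thue n) & n + 4 < size (thue n)].
Proof.
elim: n => [|n [t3 tF /prefixP[s es] /suffixP[s' es'] sz]].
  by split=> //; apply/square_freeP.
have e : thue n.+1 = morph block (thue n) by [].
split.
- exact: ternary_morph_block.
- rewrite e; apply: square_free_morph_block => //.
    by apply: sub_all t3 => x /leq_trans; apply.
  by move=> v vu _; apply: infix_windows vu.
(* The image of the initial 0 is [base_block], which begins with 0120; at the other end, the final 0
   gives 0210. *)
- by rewrite e es.
- rewrite e es' morph_cat; apply: suffix_trans (suffix_suffix _ _).
  by vm_compute.
- by rewrite e size_morph_block; lia.
Qed.

(** * Insertions and extremal words *)

Lemma insertion_square (u w1 w2 : seq nat) (x : nat) :
  (forall v, infix v (3 :: rcons u 4) -> size v <= 5 -> v \in windows (size v)) ->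
  4 < size u -> morph block (3 :: rcons u 4) = w1 ++ w2 -> x < 3 ->
  ~ square_free (w1 ++ x :: w2).
Proof.
set u' := 3 :: rcons u 4 => win u4 ew x3.
have szu : size u' = (size u).+2 by rewrite /= size_rcons.
have szw : size w1 + size w2 = (size u).+2 * 47.
  by rewrite -szu -size_morph_block ew size_cat.
(* The window starts one block before the insertion point, which thus falls in its middle block;
   truncated subtraction and [minn] keep it inside [u'], so that insertions near an end fall in the
   first or last block. *)
pose j := minn ((size w1 %/ 47).-1) (size u).-1.
pose v := take 3 (drop j u').
have szv : size v = 3 by rewrite size_takel // size_drop szu /j; lia.
have vu : infix v u' := infix_trans (infix_take _ _) (infix_drop _ _).
pose r := size w1 - j * 47.
have rlo : (if head 0 v == 3 then 0 else 47) <= r.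
  case: eqP => // hv; have [j0|] := posnP j; last by rewrite /r /j; lia.
  by case: hv; rewrite /v j0 drop0.
have rhi : r <= (if last 0 v == 4 then 141 else 94).
  case: eqP => [_|hv]; first by rewrite /r /j; lia.
  have [j0|] := eqVneq j (size u).-1; last by rewrite /r /j; lia.
  case: hv; rewrite -nth_last szv nth_take // nth_drop j0.
  have -> : (size u).-1 + 2 = (size u).+1 by lia.
  by rewrite /= nth_rcons ltnn eqxx.
have jw : j * 47 <= size w1 by rewrite /j; lia.
have e : morph block u' = morph block (take j u') ++ morph block v
         ++ morph block (drop 3 (drop j u')).
  by rewrite -!morph_cat !cat_take_drop.
have szj : size (morph block (take j u')) = j * 47.
  by rewrite size_morph_block size_takel // szu /j; lia.
have rv : r <= size (morph block v).
  by rewrite size_morph_block szv; move: rhi; case: ifP; lia.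
have ew1 : w1 = morph block (take j u') ++ take r (morph block v).
  rewrite -(take_size_cat w2 (erefl (size w1))) -ew e take_cat szj.
  by rewrite ltnNge jw /= takel_cat.
have ew2 : w2 = drop r (morph block v) ++ morph block (drop 3 (drop j u')).
  rewrite -(drop_size_cat w2 (erefl (size w1))) -ew e drop_cat szj.
  rewrite ltnNge jw /= drop_cat -/r; case: ltnP => // vr.
  have -> : r = size (morph block v) by apply/eqP; rewrite eqn_leq rv vr.
  by rewrite subnn drop0 drop_size.
move=> wF; have := win v vu; rewrite szv => /(_ isT).
move=> /(allP insert_squares_windows)/allP/(_ r).
rewrite mem_iota rlo => /(_ _)/allP/(_ x); rewrite mem_iota x3.
case/(_ _ isT)/negP; first by move: rlo rhi; do 2 case: ifP => _; lia.
apply/square_freeP; apply: square_free_infix wF.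
apply: infix_trans (infix_drop _ _) (infix_trans (infix_take _ _) _).
apply/infixP; exists (morph block (take j u')).
exists (morph block (drop 3 (drop j u'))).
by rewrite ew1 ew2 -!catA.
Qed.

Lemma square_free_bordered (u : seq nat) :
  ternary u -> square_free u -> square_free (3 :: rcons u 4).
Proof.
move=> u3 uF; have notin b : 2 < b -> b \notin u.
  by move=> b3; apply/negP=> /(allP u3); lia.
apply: square_free_cons; first by rewrite mem_rcons inE notin.
(* Reversal turns the appended 4 into a prepended letter. *)
apply: square_free_rev; rewrite rev_rcons; apply: square_free_cons.
  by rewrite mem_rev notin.
by apply: square_free_rev; rewrite revK.
Qed.

Theorem theorem1 (A : finType) (hA : #|A| = 3) (n : nat) (hn : 0 < n) :
  exists w : seq A, extremal w /\ n <= size w.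
Proof.
have sA : size (enum A) = 3 by rewrite -cardE.
have [t3 tF pre suf szt] := thueP n.
set u := thue n in t3 tF pre suf szt.
have win v := infix_bordered_windows t3 tF pre suf (v := v).
set w := morph block (3 :: rcons u 4).
have wF : square_free w.
  apply: square_free_morph_block => //; last exact: square_free_bordered.
  rewrite /= all_rcons /=; apply: sub_all t3 => x x3; exact: leq_trans x3 _.
have w3 : ternary w := ternary_morph_block _.
have /card_gt0P[a0 _] : 0 < #|A| by rewrite hA.
(* The enumeration of [A] carries words over 0, 1, 2 to words over [A]. *)
pose f := nth a0 (enum A).
have fI : {in w &, injective f}.
  move=> x y /(allP w3) x3 /(allP w3) y3 /eqP.
  by rewrite nth_uniq ?sA ?enum_uniq // => /eqP.
exists (map f w); split; last first.
  by rewrite size_map size_morph_block /= size_rcons; lia.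
split; first exact: square_free_map.
move=> e [w1 [w2 [y [ew ->]]]] eF.
(* The inserted letter is itself an image under [f], so the extension pulls back to one of [w]. *)
have yE : f (index y (enum A)) = y by rewrite /f nth_index ?mem_enum.
apply: (@insertion_square u (take (size w1) w) (drop (size w1) w)
  (index y (enum A))) => //.
- by lia.
- by rewrite cat_take_drop.
- by rewrite -sA index_mem mem_enum.
apply: (@square_free_of_map _ _ f).
by rewrite map_cat /= yE map_take map_drop ew take_size_cat // drop_size_cat.
Qed.
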